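(* For any $q\in\mathbb{C}$, the following identity holds in $\mathcal{H}_n(q)$: $$\mathcal{B}_n(q)\,\mathcal{R}_n(q)=\big(q\,\mathcal{R}_{n-1}(q)+[n]_q+q^nJ_n(q)\big)\,\mathcal{B}_n(q).$$
   Context: $\mathcal{H}_n(q)$ is the Type A Iwahori–Hecke algebra over $\mathbb{C}$ with generators $T_{s_1},\dots,T_{s_{n-1}}$ and relations $T_{s_i}^2=(q-1)T_{s_i}+q$, $T_{s_i}T_{s_j}=T_{s_j}T_{s_i}$ for $|i-j|\ge2$, $T_{s_i}T_{s_{i+1}}T_{s_i}=T_{s_{i+1}}T_{s_i}T_{s_{i+1}}$; it has basis $T_w$ ($w\in\mathfrak{S}_n$), $T_w=T_{s_{i_1}}\cdots T_{s_{i_\ell}}$ for any reduced word of $w$. $\mathcal{H}_{n-1}(q)\subseteq\mathcal{H}_n(q)$ via $T_{s_i}\mapsto T_{s_i}$. $\mathcal{B}_m(q)=\sum_{i=1}^{m}T_{s_{m-1}}\cdots T_{s_i}$, $\mathcal{B}^*_m(q)=\sum_{j=1}^{m}T_{s_j}\cdots T_{s_{m-1}}$ (empty products equal $1$), $\mathcal{R}_m(q)=\mathcal{B}^*_m(q)\mathcal{B}_m(q)$. $[n]_q=1+q+\dots+q^{n-1}$. The Jucys–Murphy element is $J_n(q)=\sum_{i=1}^{n-1}q^{i-n}T_{(i,n)}$ for $q\ne0$, where $(i,n)$ is a transposition; thus $q^nJ_n(q)=\sum_{i=1}^{n-1}q^{i}T_{(i,n)}$, which is defined for all $q\in\mathbb{C}$.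 *)

(* Defs.v *)
From HB Require Import structures.
From mathcomp Require Import all_fingroup.
From mathcomp Require Import all_boot all_order all_algebra.
From mathcomp Require Import monalg.
From mathcomp Require Import boolp reals.
From mathcomp Require Import complex.

Set Implicit Arguments.
Unset Strict Implicit.
Unset Printing Implicit Defensive.

Import GRing.Theory.

Local Open Scope ring_scope.
Local Open Scope quotient_scope.

Section QuotientAlgebra.
Variables (F : fieldType) (A : algType F) (rel : A -> Prop).

(* The two-sided ideal of A generated by rel. *)
Inductive gen_ideal : A -> Prop :=
| gen_ideal_rel x : rel x -> gen_ideal x
| gen_ideal0 : gen_ideal 0
| gen_idealB x y : gen_ideal x -> gen_ideal y -> gen_ideal (x - y)
| gen_idealMl a x : gen_ideal x -> gen_ideal (a * x)
| gen_idealMr a x : gen_ideal x -> gen_ideal (x * a).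

Definition in_gen_ideal : {pred A} := fun x => `[< gen_ideal x >].

Lemma gen_ideal_zmod_closed : zmod_closed in_gen_ideal.
Proof.
split; first by apply/asboolP; exact: gen_ideal0.
by move=> x y /asboolP hx /asboolP hy; apply/asboolP; exact: gen_idealB.
Qed.

HB.instance Definition _ :=
  GRing.isZmodClosed.Build A in_gen_ideal gen_ideal_zmod_closed.

Definition quot_alg : Type := @Quotient.quot A in_gen_ideal.
HB.instance Definition _ := GRing.Zmodule.on quot_alg.

Definition qpi : A -> quot_alg := \pi_(@Quotient.quot A in_gen_ideal).

Lemma qpiP x y : reflect (gen_ideal (x - y)) (qpi x == qpi y).
Proof. by rewrite /qpi -Quotient.idealrBE; exact: asboolP. Qed.

Lemma qpi_repr (u : quot_alg) : qpi (repr u) = u.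
Proof. exact: reprK. Qed.

Lemma qpiB : zmod_morphism qpi.
Proof. by move=> x y; rewrite /qpi !piE. Qed.

HB.instance Definition _ := GRing.isZmodMorphism.Build A quot_alg qpi qpiB.

Definition qone : quot_alg := qpi 1.
Definition qmul (u v : quot_alg) : quot_alg := qpi (repr u * repr v).
Definition qscale (c : F) (u : quot_alg) : quot_alg := qpi (c *: repr u).

Lemma qpi_mul x y : qmul (qpi x) (qpi y) = qpi (x * y).
Proof.
have ker z : gen_ideal (repr (qpi z) - z) by apply/qpiP; rewrite qpi_repr.
apply/eqP/qpiP; set x' := repr _; set y' := repr _.
have -> : x' * y' - x * y = (x' - x) * y' - (0 - x * (y' - y)).
  by rewrite sub0r opprK mulrBl mulrBr addrA subrK.
apply: gen_idealB; first exact/gen_idealMr/ker.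
by apply: gen_idealB; [exact: gen_ideal0 | exact/gen_idealMl/ker].
Qed.

Lemma qpi_scale c x : qscale c (qpi x) = qpi (c *: x).
Proof.
apply/eqP/qpiP; rewrite -scalerBr -[_ - x]mul1r scalerAl.
by apply: gen_idealMl; apply/qpiP; rewrite qpi_repr.
Qed.

Let lift1 (P : quot_alg -> Prop) : (forall x, P (qpi x)) -> forall u, P u.
Proof. by move=> h u; rewrite -[u]qpi_repr. Qed.

Lemma qmulA : associative qmul.
Proof.
by elim/lift1=> x; elim/lift1=> y; elim/lift1=> z; rewrite !qpi_mul mulrA.
Qed.

Lemma qmul1l : left_id qone qmul.
Proof. by elim/lift1=> x; rewrite qpi_mul mul1r. Qed.

Lemma qmul1r : right_id qone qmul.
Proof. by elim/lift1=> x; rewrite qpi_mul mulr1. Qed.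

Lemma qmulDl : left_distributive qmul +%R.
Proof.
elim/lift1=> x; elim/lift1=> y; elim/lift1=> z.
by rewrite -raddfD !qpi_mul mulrDl raddfD.
Qed.

Lemma qmulDr : right_distributive qmul +%R.
Proof.
elim/lift1=> x; elim/lift1=> y; elim/lift1=> z.
by rewrite -raddfD !qpi_mul mulrDr raddfD.
Qed.

HB.instance Definition _ := GRing.Zmodule_isPzRing.Build quot_alg
  qmulA qmul1l qmul1r qmulDl qmulDr.

Lemma qscaleA a b u : qscale a (qscale b u) = qscale (a * b) u.
Proof. by elim/lift1: u => x; rewrite !qpi_scale scalerA. Qed.

Lemma qscale1 : left_id 1 qscale.
Proof. by elim/lift1=> x; rewrite qpi_scale scale1r. Qed.

Lemma qscaleDr : right_distributive qscale +%R.
Proof.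
move=> a; elim/lift1=> x; elim/lift1=> y.
by rewrite -raddfD !qpi_scale scalerDr raddfD.
Qed.

Lemma qscaleDl u : {morph qscale^~ u : a b / a + b}.
Proof. by elim/lift1: u => x a b; rewrite /= !qpi_scale scalerDl raddfD. Qed.

HB.instance Definition _ := GRing.Zmodule_isLmodule.Build F quot_alg
  qscaleA qscale1 qscaleDr qscaleDl.

Lemma qpiD x y : qpi (x + y) = qpi x + qpi y.
Proof. exact: raddfD. Qed.

Lemma qpi1 : qpi 1 = 1.
Proof. by []. Qed.

Lemma qpiM x y : qpi (x * y) = qpi x * qpi y.
Proof. by rewrite -qpi_mul. Qed.

Lemma qpiZ c x : qpi (c *: x) = c *: qpi x.
Proof. by rewrite -qpi_scale. Qed.

Lemma qpi_scaleAl (a : F) (u v : quot_alg) : a *: (u * v) = (a *: u) * v.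
Proof.
elim/lift1: u => x; elim/lift1: v => y.
by rewrite -qpiM -!qpiZ -qpiM scalerAl.
Qed.

Lemma qpi_scaleAr (a : F) (u v : quot_alg) : a *: (u * v) = u * (a *: v).
Proof.
elim/lift1: u => x; elim/lift1: v => y.
by rewrite -qpiM -!qpiZ -qpiM scalerAr.
Qed.

Lemma qpi_rel x y : rel (x - y) -> qpi x = qpi y.
Proof. by move=> h; apply/eqP/qpiP; exact: gen_ideal_rel. Qed.

Lemma qpi_quadratic x a b :
  rel (x * x - (a *: x + b%:A)) -> qpi x * qpi x = a *: qpi x + b *: (1 : quot_alg).
Proof. by move=> /qpi_rel; rewrite qpiM qpiD !qpiZ. Qed.

Lemma qpi_commute x y : rel (x * y - y * x) -> qpi x * qpi y = qpi y * qpi x.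
Proof. by move=> /qpi_rel; rewrite !qpiM. Qed.

Lemma qpi_braid x y :
  rel (x * y * x - y * x * y) -> qpi x * qpi y * qpi x = qpi y * qpi x * qpi y.
Proof. by move=> /qpi_rel; rewrite !qpiM. Qed.

Lemma quot_alg_neq0 (B : nzRingType) (f : {rmorphism A -> B}) :
  (forall x, rel x -> f x = 0) -> (1 : quot_alg) != 0.
Proof.
move=> frel; have fI x : gen_ideal x -> f x = 0.
  elim=> {x} [||x y _ hx _ hy|a x _ hx|a x _ hx]; first exact: frel.
  - exact: rmorph0.
  - by rewrite rmorphB hx hy subrr.
  - by rewrite rmorphM hx mulr0.
  - by rewrite rmorphM hx mul0r.
rewrite -[0](raddf0 qpi); apply/negP=> /qpiP /fI.
by rewrite subr0 rmorph1; apply/eqP; exact: oner_neq0.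
Qed.

End QuotientAlgebra.

(* Indices i with 1 <= i <= n-1 of the generators T_{s_i}. *)
Definition gen_index (n : nat) : Type := {i : nat | (0 < i < n)%N}.
HB.instance Definition _ n := Choice.on (gen_index n).

(* The free associative unital F-algebra on the letters gen_index n. *)
Definition free_hecke (F : fieldType) (n : nat) : Type :=
  {malg F[{fmonom gen_index n}]}.
HB.instance Definition _ (F : fieldType) n := GRing.Lalgebra.on (free_hecke F n).

Lemma free_hecke_scaleAr (F : fieldType) n (a : F) (x y : free_hecke F n) :
  a *: (x * y) = x * (a *: y).
Proof.
have central (z : free_hecke F n) : z * malgC a = a *: z.
  rewrite -mul_malgC; apply: etrans (fgmulgU _ _ _) _.
  apply: etrans (esym (fgmulUg _ _ _)).
  by apply: eq_bigr => k _; rewrite mulm1 mul1m mulrC.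
by rewrite -[a *: y]mul_malgC mulrA central scalerAl.
Qed.

HB.instance Definition _ (F : fieldType) n := GRing.Lalgebra_isAlgebra.Build F
  (free_hecke F n) (@free_hecke_scaleAr F n).

Definition letter (F : fieldType) n (k : gen_index n) : free_hecke F n :=
  << fmu k >>.

Section Presentation.
Variables (F : fieldType) (n : nat) (q : F).

Local Notation x_ k := (letter F k).

Inductive hecke_relator : free_hecke F n -> Prop :=
| relator_quadratic (k : gen_index n) :
    hecke_relator (x_ k * x_ k - ((q - 1) *: x_ k + q%:A))
| relator_commute (j k : gen_index n) :
    (val j + 2 <= val k)%N || (val k + 2 <= val j)%N ->
    hecke_relator (x_ j * x_ k - x_ k * x_ j)
| relator_braid (j k : gen_index n) :
    val k = (val j).+1 ->
    hecke_relator (x_ j * x_ k * x_ j - x_ k * x_ j * x_ k).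

Definition hecke : Type := quot_alg hecke_relator.
HB.instance Definition _ := GRing.Lmodule.on hecke.
HB.instance Definition _ := GRing.PzRing.on hecke.

(* The one-dimensional representation T_{s_i} |-> q shows that 1 != 0. *)
Definition index_char (m : {fmonom gen_index n}) : F := q ^+ fdeg m.

Lemma index_char_mmorphism : mmorphism index_char.
Proof.
by split=> [x y|]; rewrite /index_char ?fdegM ?exprD // fdeg1 expr0.
Qed.

HB.instance Definition _ := monalg.isMultiplicative.Build
  {fmonom gen_index n} F index_char index_char_mmorphism.

Definition index_rep : {rmorphism free_hecke F n -> F} :=
  GRing.RMorphism.clone _ _ (mmap idfun index_char) _.

Lemma index_rep_letter k : index_rep (x_ k) = q.
Proof. by apply: etrans (mmapU _ _) _; rewrite /index_char fdegU mul1r. Qed.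

Lemma index_repZ c x : index_rep (c *: x) = c * index_rep x.
Proof. exact: mmapZ. Qed.

Lemma index_rep_relator x : hecke_relator x -> index_rep x = 0.
Proof.
have subE y z c d :
    index_rep y = c -> index_rep z = d -> index_rep (y - z) = c - d.
  by move=> <- <-; exact: rmorphB.
have mulE y z c d :
    index_rep y = c -> index_rep z = d -> index_rep (y * z) = c * d.
  by move=> <- <-; exact: rmorphM.
have letE := index_rep_letter.
case=> {x} [k|j k _|j k _].
- have linE : index_rep ((q - 1) *: x_ k + q%:A) = (q - 1) * q + q * 1.
    apply: etrans (rmorphD _ _ _) _; congr (_ + _).
      by apply: etrans (index_repZ _ _) _; rewrite letE.
    by apply: etrans (index_repZ _ _) _; rewrite rmorph1.
  apply: etrans (subE _ _ _ _ (mulE _ _ _ _ (letE k) (letE k)) linE) _.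
  by rewrite mulr1 mulrBl mul1r subrK subrr.
- apply: etrans (subE _ _ _ _ (mulE _ _ _ _ (letE j) (letE k))
    (mulE _ _ _ _ (letE k) (letE j))) _.
  by rewrite subrr.
- apply: etrans (subE _ _ _ _
    (mulE _ _ _ _ (mulE _ _ _ _ (letE j) (letE k)) (letE j))
    (mulE _ _ _ _ (mulE _ _ _ _ (letE k) (letE j)) (letE k))) _.
  by rewrite subrr.
Qed.

HB.instance Definition _ := GRing.PzSemiRing_isNonZero.Build hecke
  (quot_alg_neq0 index_rep_relator).
HB.instance Definition _ := GRing.Lmodule_isLalgebra.Build F hecke
  (@qpi_scaleAl F _ hecke_relator).
HB.instance Definition _ := GRing.Lalgebra_isAlgebra.Build F hecke
  (@qpi_scaleAr F _ hecke_relator).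

Definition hecke_gen (k : gen_index n) : hecke := qpi hecke_relator (x_ k).

Lemma hecke_gen_quadratic k :
  hecke_gen k * hecke_gen k = (q - 1) *: hecke_gen k + q%:A.
Proof. exact: (qpi_quadratic (relator_quadratic k)). Qed.

Lemma hecke_gen_commute (j k : gen_index n) :
  (val j + 2 <= val k)%N || (val k + 2 <= val j)%N ->
  hecke_gen j * hecke_gen k = hecke_gen k * hecke_gen j.
Proof. by move=> hjk; exact: (qpi_commute (relator_commute hjk)). Qed.

Lemma hecke_gen_braid (j k : gen_index n) :
  val k = (val j).+1 ->
  hecke_gen j * hecke_gen k * hecke_gen j
  = hecke_gen k * hecke_gen j * hecke_gen k.
Proof. by move=> hjk; exact: (qpi_braid (relator_braid hjk)). Qed.

(* T_{s_i} for 1 <= i <= n-1; the value at other i is junk and never used. *)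
Definition Ts (i : nat) : hecke := oapp hecke_gen 0 (insub i).

End Presentation.

(* The transposition (i,j) for 1 <= i, j <= n; the points 1, ..., n of S_n are
   the elements 0, ..., n-1 of 'I_n. *)
Definition transp (n i j : nat) : 'S_n :=
  if (insub i.-1, insub j.-1) is (Some a, Some b) then tperm a b else 1%g.

Lemma transpE n (a b : 'I_n) : transp n a.+1 b.+1 = tperm a b.
Proof. by rewrite /transp /= !valK. Qed.

Section ReducedWords.
Variable n : nat.

Definition simple_transp (k : gen_index n) : 'S_n :=
  transp n (val k) (val k).+1.

(* Permutations are composed left to right here. Composing right to left
   instead turns the reduced words of w into those of w^-1; the only T_w used
   below are those of transpositions, so the convention is immaterial. *)
Definition word_perm (s : seq (gen_index n)) : 'S_n :=
  (\prod_(k <- s) simple_transp k)%g.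

Definition reduced_word (w : 'S_n) (s : seq (gen_index n)) : Prop :=
  word_perm s = w /\
  forall t : seq (gen_index n), word_perm t = w -> (size s <= size t)%N.

Lemma word_perm_cat s t : word_perm (s ++ t) = (word_perm s * word_perm t)%g.
Proof. exact: big_cat. Qed.

Lemma tperm_word1 (a b : 'I_n) : (a.+1 = b)%N -> exists s, word_perm s = tperm a b.
Proof.
move=> hab; have hk : (0 < b < n)%N by rewrite ltn_ord -hab.
exists [:: exist _ (val b) hk]; rewrite /word_perm big_seq1.
by rewrite /simple_transp /= -transpE; congr transp.
Qed.

Lemma tperm_word d (a b : 'I_n) :
  (a + d.+1 = b)%N -> exists s, word_perm s = tperm a b.
Proof.
elim: d b => [|d IHd] b hab; first by apply: tperm_word1; rewrite -addn1.
have hc : (a + d.+1 < n)%N.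
  by apply: leq_ltn_trans (ltn_ord b); rewrite -hab leq_add2l.
pose c := Ordinal hc.
have [s hs] := IHd c erefl.
have [t ht] : exists t, word_perm t = tperm c b.
  by apply: tperm_word1; rewrite /= -addnS.
exists (t ++ s ++ t); rewrite !word_perm_cat hs ht.
have ca : c != a by rewrite -val_eqE /= -[X in _ != X]addn0 eqn_add2l.
have ba : b != a by rewrite -val_eqE /= -hab -[X in _ != X]addn0 eqn_add2l.
have := tpermJ a c (tperm c b); rewrite tpermL (tpermD ca ba) => <-.
by rewrite conjgE tpermV.
Qed.

Lemma perm_word (w : 'S_n) : exists s, word_perm s = w.
Proof.
have [ts -> _] := prod_tpermP w.
elim: ts => [|[a b] ts [s hs]]; first by exists [::]; rewrite /word_perm !big_nil.
have [t ht] : exists t, word_perm t = tperm a b.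
  case: (ltngtP a b) => [lt_ab|lt_ba|/val_inj->].
  - by apply: (@tperm_word (b - a.+1)); rewrite -addSnnS subnKC.
  - by rewrite tpermC; apply: (@tperm_word (a - b.+1)); rewrite -addSnnS subnKC.
  - by exists [::]; rewrite /word_perm big_nil tperm1.
by exists (t ++ s); rewrite word_perm_cat ht hs big_cons.
Qed.

Lemma reduced_word_exists (w : 'S_n) : exists s, reduced_word w s.
Proof.
pose P m := `[< exists2 s, word_perm s = w & size s = m >].
have exP : exists m, P m.
  by have [s hs] := perm_word w; exists (size s); apply/asboolP; exists s.
case: (ex_minnP exP) => m /asboolP[s hs hm] minm.
exists s; split=> // t ht; rewrite hm; apply: minm.
by apply/asboolP; exists t.
Qed.

Definition some_reduced_word (w : 'S_n) : seq (gen_index n) :=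
  sval (cid (reduced_word_exists w)).

End ReducedWords.

Section HeckeElements.
Variables (F : fieldType) (n : nat) (q : F).

Local Notation H := (hecke n q).

(* By Matsumoto's theorem the product is the same for every reduced word of w. *)
Definition Tw (w : 'S_n) : H :=
  \prod_(k <- some_reduced_word w) hecke_gen q k.

(* The elements with index m are taken inside H_n, i.e. for m <= n they are
   the images of the elements of H_m under T_{s_i} |-> T_{s_i}. *)
Definition Bm (m : nat) : H :=
  \sum_(1 <= i < m.+1) \prod_(k <- rev (index_iota i m)) Ts n q k.

Definition Bstar (m : nat) : H :=
  \sum_(1 <= j < m.+1) \prod_(j <= k < m) Ts n q k.

Definition Rm (m : nat) : H := Bstar m * Bm m.

Definition JM : H := \sum_(1 <= i < n) q ^- (n - i) *: Tw (transp n i n).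

(* q^n J_n, in the form that makes sense for all q. *)
Definition qnJM : H := \sum_(1 <= i < n) q ^+ i *: Tw (transp n i n).

Lemma qnJME : q != 0 -> qnJM = q ^+ n *: JM.
Proof.
move=> q0; rewrite scaler_sumr [qnJM]big_nat [RHS]big_nat.
apply: eq_bigr => i /andP[_ /ltnW le_in].
have -> : q ^+ n = q ^+ (n - i) * q ^+ i by rewrite -exprD subnK.
by rewrite scalerA mulrAC divff ?mul1r // expf_neq0.
Qed.

End HeckeElements.

Definition qint (F : fieldType) (m : nat) (q : F) : F := \sum_(i < m) q ^+ i.

(* Main.v *)
(** Write n = m+1, a_i = T_{n-1} ... T_i, b_j = T_j ... T_{n-1}, so that B_n is
    the sum of the a_i and B*_n the sum of the b_j; primes denote n-1 instead of
    n.  Braid relations give a_i b_{j+1} = b'_j a_i and a_{j+1} b_i = b_i a'_j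
    for i <= j, so the off-diagonal part of B_n B*_n is B*_{n-1} T_m B_{n-1} plus
    the diagonal elements b'_k T_m a'_k = T_{(k,n)}.  The quadratic relation
    expands a_i b_i recursively, and altogether
      B_n B*_n = B*_{n-1} T_m B_{n-1} + [n]_q + \sum_k q^k T_{(k,n)}.
    Multiplying by B_n on the right, it remains to see that
    T_m B_{n-1} B_n = q B_{n-1} B_n: since a_i a_{j+1} = a'_j a_i for i <= j,
    B_{n-1} B_n is a left multiple of 1 + T_m.

    That T_{(i,n)} is b'_i a_i for any choice of reduced word needs no Matsumoto
    theorem: by commutation and braid moves a reduced word becomes u v with u a
    word in s_1, ..., s_{m-1} and v = s_m ... s_j.  Following the point n gives
    j = i, and then u has at most m - i letters but must carry i to m, which
    forces u = s_i ... s_{m-1}. *)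

Require Import Defs.
From HB Require Import structures.
From mathcomp Require Import all_fingroup.
From mathcomp Require Import all_boot all_order all_algebra.
From mathcomp Require Import ssrAC zify boolp reals complex.

Set Implicit Arguments.
Unset Strict Implicit.
Unset Printing Implicit Defensive.

Import GRing.Theory.
Local Open Scope ring_scope.

(** * Braid relations and monotone runs of generators *)

Definition braid_family (A : pzRingType) (T : nat -> A) : Prop :=
  (forall j k, (j.+1 < k)%N -> T j * T k = T k * T j) /\
  (forall j, T j * T j.+1 * T j = T j.+1 * T j * T j.+1).

Section Runs.
Variables (A : pzRingType) (T : nat -> A).

(** In the notation above, a_i is [desc i n] and b_j is [asc j n]; the primed runs end at n-1
    instead. *)
Definition desc (i m : nat) : A := \prod_(k <- rev (index_iota i m)) T k.
Definition asc (i m : nat) : A := \prod_(i <= k < m) T k.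

Lemma rev_iotaSl i m : (i < m)%N ->
  rev (index_iota i m) = rcons (rev (index_iota i.+1 m)) i.
Proof. by move=> im; rewrite /index_iota -(subnSK im) /= rev_cons. Qed.

Lemma rev_iotaSr i m : (i <= m)%N ->
  rev (index_iota i m.+1) = m :: rev (index_iota i m).
Proof.
move=> im; rewrite /index_iota subSn // -addn1 iotaD subnKC //.
by rewrite rev_cat.
Qed.

Lemma desc_geq i m : (m <= i)%N -> desc i m = 1.
Proof. by move=> mi; rewrite /desc /index_iota (eqP mi) big_nil. Qed.

Lemma asc_geq i m : (m <= i)%N -> asc i m = 1.
Proof. by move=> mi; rewrite /asc big_geq. Qed.

Lemma descSr i m : (i <= m)%N -> desc i m.+1 = T m * desc i m.
Proof.
by move=> im; rewrite /desc rev_iotaSr // big_cons.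
Qed.

Lemma descSl i m : (i < m)%N -> desc i m = desc i.+1 m * T i.
Proof. by move=> im; rewrite /desc rev_iotaSl // -cats1 big_cat big_seq1. Qed.

Lemma ascSr i m : (i <= m)%N -> asc i m.+1 = asc i m * T m.
Proof. by move=> im; rewrite /asc big_nat_recr. Qed.

Lemma ascSl i m : (i < m)%N -> asc i m = T i * asc i.+1 m.
Proof. by move=> im; rewrite /asc big_ltn. Qed.

Hypothesis braidT : braid_family T.

Lemma desc_commr i m k : (m < k)%N -> desc i m * T k = T k * desc i m.
Proof.
elim: m => [|m IHm] mk; first by rewrite desc_geq // mul1r mulr1.
have [mi|im] := ltnP m i; first by rewrite desc_geq // mul1r mulr1.
by rewrite descSr // -mulrA IHm ?(ltnW mk) // !mulrA braidT.1.
Qed.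

Lemma asc_commr i m k : (m < k)%N -> asc i m * T k = T k * asc i m.
Proof.
elim: m => [|m IHm] mk; first by rewrite asc_geq // mul1r mulr1.
have [mi|im] := ltnP m i; first by rewrite asc_geq // mul1r mulr1.
by rewrite ascSr // -mulrA braidT.1 // !mulrA IHm // ltnW.
Qed.

Lemma desc_comml i m k : (k.+1 < i)%N -> desc i m * T k = T k * desc i m.
Proof.
move=> ki; elim: m => [|m IHm]; first by rewrite desc_geq // mul1r mulr1.
have [mi|im] := ltnP m i; first by rewrite desc_geq // mul1r mulr1.
by rewrite descSr // -mulrA IHm !mulrA -braidT.1 // (leq_trans ki).
Qed.

(** The letter k+1 commutes leftwards past everything below k, a braid move turns T_{k+1} T_k
    T_{k+1} into T_k T_{k+1} T_k, and the new T_k commutes past the rest of the run. *)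
Lemma desc_shift i m k : (i <= k)%N -> (k.+1 < m)%N ->
  desc i m * T k.+1 = T k * desc i m.
Proof.
move=> ik; elim: m => // m IHm; rewrite ltnS leq_eqVlt => /orP[/eqP<-|km].
  rewrite descSr ?(leqW ik) // descSr // -!mulrA desc_commr // !mulrA.
  by rewrite braidT.2.
have im : (i <= m)%N by rewrite (leq_trans ik) // ltnW // ltnW.
by rewrite descSr // -mulrA IHm // !mulrA -braidT.1.
Qed.

Lemma asc_shift i m k : (i <= k)%N -> (k.+1 < m)%N ->
  asc i m * T k = T k.+1 * asc i m.
Proof.
move=> ik; elim: m => // m IHm; rewrite ltnS leq_eqVlt => /orP[/eqP<-|km].
  rewrite ascSr ?(leqW ik) // ascSr // -!mulrA (mulrA (T k)) braidT.2 !mulrA.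
  by rewrite asc_commr.
have im : (i <= m)%N by rewrite (leq_trans ik) // ltnW // ltnW.
by rewrite ascSr // -mulrA -braidT.1 // !mulrA IHm.
Qed.

Lemma desc_asc_gt i j m : (i <= j)%N -> (j <= m)%N ->
  desc i m.+1 * asc j.+1 m.+1 = asc j m * desc i m.+1.
Proof.
(* Only the ascending run is shortened to an end p <= m; the descending one stays whole, so each
   letter can be passed through it by [desc_shift]. *)
move=> ij; have: (m <= m)%N by []; move: {1 3 5 6}m => p.
elim: p => [|p IHp] pm jp; first by rewrite !asc_geq // mul1r mulr1.
move: jp; rewrite leq_eqVlt => /orP[/eqP->|jp].
  by rewrite !asc_geq // mul1r mulr1.
rewrite ascSr // mulrA IHp ?(ltnW pm) // ascSr // -!mulrA desc_shift //.
exact: leq_trans ij jp.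
Qed.

Lemma desc_desc i j m : (i <= j)%N -> (j <= m)%N ->
  desc i m.+1 * desc j.+1 m.+1 = desc j m * desc i m.+1.
Proof.
move=> ij; have: (m <= m)%N by []; move: {1 3 5 6}m => p.
elim: p => [|p IHp] pm jp.
  by rewrite (@desc_geq j.+1) ?(@desc_geq j) ?mul1r ?mulr1.
move: jp; rewrite leq_eqVlt => /orP[/eqP->|jp].
  by rewrite (@desc_geq p.+2) ?(@desc_geq p.+1) ?mul1r ?mulr1.
rewrite (@descSr j.+1) // mulrA desc_shift ?(leq_trans ij jp) //.
by rewrite -mulrA IHp ?(ltnW pm) // (@descSr j) // mulrA.
Qed.

Lemma desc_asc_lt i j m : (i <= j)%N -> (j <= m)%N ->
  desc j.+1 m.+1 * asc i m.+1 = asc i m.+1 * desc j m.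
Proof.
move=> ij; have: (m <= m)%N by []; move: {1 3 4 7}m => p.
elim: p => [|p IHp] pm jp.
  by rewrite (@desc_geq j.+1) ?(@desc_geq j) ?mul1r ?mulr1.
move: jp; rewrite leq_eqVlt => /orP[/eqP->|jp].
  by rewrite (@desc_geq p.+2) ?(@desc_geq p.+1) ?mul1r ?mulr1.
rewrite descSr // -mulrA IHp ?(ltnW pm) // descSr // !mulrA asc_shift //.
exact: leq_trans ij jp.
Qed.

End Runs.

(** * Splitting double sums along the diagonal *)

Section DoubleSums.
Variables (V : nmodType) (f : nat -> nat -> V).

(** On the right the terms with i = j occur twice, which the extra diagonal sum on the left makes up
    for. *)
Lemma sum_square m :
  \sum_(1 <= i < m.+1) \sum_(1 <= j < m.+1) f i j +
    \sum_(1 <= i < m.+1) f i i =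
  \sum_(1 <= j < m.+1) \sum_(1 <= i < j.+1) (f i j + f j i).
Proof.
elim: m => [|m IHm]; first by rewrite !big_geq // addr0.
rewrite !(big_nat_recr m.+1) //= -IHm.
under eq_bigr do rewrite big_nat_recr //=.
rewrite !big_split /=.
by rewrite [LHS](AC ((2*2)*2) ((1*5)*((2*3)*(4*6)))).
Qed.

(** Entries strictly above the diagonal are matched with those on or below it. *)
Lemma sum_rectangle m :
  \sum_(1 <= i < m.+1) \sum_(1 <= j < m.+2) f i j =
  \sum_(1 <= j < m.+1) \sum_(1 <= i < j.+1) (f i j.+1 + f j i).
Proof.
elim: m => [|m IHm]; first by rewrite !big_geq.
rewrite [RHS]big_nat_recr //= -IHm [LHS]big_nat_recr //=.
under eq_bigr do rewrite big_nat_recr //=.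
rewrite !big_split /= (big_nat_recr m.+2) //=.
rewrite [\sum_(1 <= i < m.+2) f i m.+2]big_nat_recr //=.
by rewrite [LHS](AC (2*2) (1*((2*4)*3))).
Qed.

Lemma sum_square_diag m :
  \sum_(1 <= i < m.+2) \sum_(1 <= j < m.+2) f i j =
  \sum_(1 <= i < m.+2) f i i +
  \sum_(1 <= j < m.+1) \sum_(1 <= i < j.+1) (f i j.+1 + f j.+1 i).
Proof.
elim: m => [|m IHm]; first by rewrite !big_nat1 big_geq ?addr0.
rewrite [LHS]big_nat_recr //=.
under eq_bigr do rewrite big_nat_recr //=.
rewrite !big_split /= IHm (big_nat_recr m.+2) //=.
rewrite [\sum_(1 <= i < m.+3) f i i]big_nat_recr //=.
rewrite [\sum_(1 <= j < m.+2) \sum_(1 <= i < _) _]big_nat_recr //= big_split /=.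
by rewrite [LHS](AC ((2*1)*2) ((1*5)*(2*(3*4)))).
Qed.

End DoubleSums.

(** * The identity in any algebra with braid and quadratic relations *)

Section Identity.
Variables (F : fieldType) (A : algType F) (T : nat -> A) (q : F) (m : nat).
Hypothesis braidT : braid_family T.
Hypothesis quadT :
  forall k, (0 < k <= m)%N -> T k * T k = (q - 1) *: T k + q%:A.

Local Notation desc := (desc T).
Local Notation asc := (asc T).
Local Notation B n := (\sum_(1 <= i < n.+1) desc i n).
Local Notation Bs n := (\sum_(1 <= j < n.+1) asc j n).
(** This is b'_k T_m a'_k, later identified with T_{(k,n)}. *)
Local Notation J k := (asc k m * desc k m.+1).

(** The quadratic relation factors as (T_k - q)(T_k + 1) = 0. *)
Lemma quadT_left k : (0 < k <= m)%N -> T k * (1 + T k) = q *: (1 + T k).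
Proof.
move=> km; rewrite mulrDr mulr1 quadT //.
by rewrite scalerBl scale1r scalerDr addrA (addrC (T k)) subrK addrC.
Qed.

Lemma top_gen_absorb : T m * (B m * B m.+1) = q *: (B m * B m.+1).
Proof.
(* The quadratic relation says nothing about T_0, but B_0 is an empty sum, so both sides vanish. *)
have [->|m0] := posnP m; first by rewrite big_geq // !mul0r mulr0 scaler0.
suff -> : B m * B m.+1 = (1 + T m) * \sum_(1 <= j < m.+1)
    \sum_(1 <= i < j.+1) desc i m * desc j.+1 m.+1.
  by rewrite mulrA quadT_left ?m0 ?leqnn // scalerAl.
rewrite mulr_suml; under eq_bigr do rewrite mulr_sumr.
rewrite sum_rectangle mulr_sumr; apply: eq_big_nat => j /andP[_ jm].
rewrite mulr_sumr; apply: eq_big_nat => i /andP[_ ij].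
(* The term indexed (j, i) is T_m times the term indexed (i, j+1). *)
rewrite -(@desc_desc _ _ braidT i j) // mulrDl mul1r mulrA -descSr //.
exact: leq_trans ij jm.
Qed.

(** Expand T_i T_i in the middle of a_i b_i; its linear term a_{i+1} T_i b_{i+1} equals [J i], by
    another word for the same transposition. *)
Lemma diag_step i : (0 < i <= m)%N ->
  desc i m.+1 * asc i m.+1 =
  q *: (desc i.+1 m.+1 * asc i.+1 m.+1) + (q - 1) *: J i.
Proof.
move=> im; have [i0 im1] := andP im.
have eJ : J i = desc i.+1 m.+1 * T i * asc i.+1 m.+1.
  rewrite -mulrA -ascSl // desc_asc_lt // ascSr // -mulrA -descSr //.
rewrite eJ descSl // (@ascSl _ _ i) // !mulrA -(mulrA _ (T i) (T i)) quadT //.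
by rewrite mulrDr mulrDl -!scalerAr mulr1 -!scalerAl addrC.
Qed.

(** Iterating [diag_step], the last product accumulates the coefficient [p] and leaves behind [p](q
    - 1) = q^p - 1 times [J p]. *)
Lemma diag_sum p : (0 < p <= m.+1)%N ->
  \sum_(1 <= i < p.+1) desc i m.+1 * asc i m.+1 =
  qint p q *: (desc p m.+1 * asc p m.+1) +
  \sum_(1 <= k < p) (q ^+ k - 1) *: J k.
Proof.
elim: p => // -[|p] IHp pm.
  by rewrite big_nat1 /qint big_ord1 scale1r big_geq ?addr0.
rewrite big_nat_recr //= IHp ?(ltnW pm) // diag_step //.
rewrite [in RHS](big_nat_recr p.+1) //= scalerDr !scalerA.
have -> : qint p.+2 q = qint p.+1 q * q + 1.
  rewrite /qint big_ord_recl expr0 addrC mulr_suml; congr (_ + _).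
  by apply: eq_bigr => i _; rewrite -exprSr.
have -> : qint p.+1 q * (q - 1) = q ^+ p.+1 - 1.
  by rewrite subrX1 mulrC.
by rewrite [in RHS]scalerDl scale1r [LHS](AC (3*1) ((1*4)*(3*2))).
Qed.

Lemma B_Bs : B m.+1 * Bs m.+1 =
  Bs m * T m * B m + (qint m.+1 q)%:A + \sum_(1 <= k < m.+1) q ^+ k *: J k.
Proof.
rewrite mulr_suml; under eq_bigr do rewrite mulr_sumr.
rewrite sum_square_diag diag_sum ?leqnn //.
have <- : Bs m * T m * B m + \sum_(1 <= k < m.+1) J k =
    \sum_(1 <= j < m.+1) \sum_(1 <= i < j.+1)
      (desc i m.+1 * asc j.+1 m.+1 + desc j.+1 m.+1 * asc i m.+1).
  rewrite !mulr_suml; under eq_bigr do rewrite mulr_sumr.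
  have -> : \sum_(1 <= k < m.+1) J k =
      \sum_(1 <= k < m.+1) asc k m * T m * desc k m.
    by apply: eq_big_nat => k /andP[_ km]; rewrite descSr // mulrA.
  rewrite (sum_square (fun i j => asc i m * T m * desc j m)).
  apply: eq_big_nat => j /andP[_ jm]; apply: eq_big_nat => i /andP[_ ij].
  have im : (i <= m)%N by apply: leq_trans ij jm.
  by rewrite desc_asc_gt // desc_asc_lt // descSr // ascSr // mulrA addrC.
(* The negative copies of [J k] cancel those from the off-diagonal part. The runs left at p = m+1
   are empty, so [n] remains. *)
under [\sum_(1 <= k < m.+1) (q ^+ k - 1) *: _]eq_bigr
  do rewrite scalerBl scale1r.
rewrite big_split sumrN /= desc_geq // asc_geq // mulr1.
by rewrite [LHS](AC ((1*2)*2) ((4*1*2)*(5*3))) /= subrr addr0.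
Qed.

Lemma B_Bs_B : B m.+1 * (Bs m.+1 * B m.+1) =
  (q *: (Bs m * B m) + (qint m.+1 q)%:A + \sum_(1 <= k < m.+1) q ^+ k *: J k) *
    B m.+1.
Proof.
rewrite mulrA B_Bs !mulrDl; congr (_ + _ + _).
by rewrite -!mulrA top_gen_absorb -scalerAr -scalerAl -!mulrA.
Qed.

End Identity.

(** * Braid relations for Hecke generators and for permutations *)

(* Extension by 0 satisfies the braid relations at all indices, without range
   conditions. *)
Definition ext_gens n (A : pzRingType) (g : gen_index n -> A) (k : nat) : A :=
  oapp g 0 (insub k).

Definition braid_gens n (A : pzRingType) (g : gen_index n -> A) : Prop :=
  (forall j k, ((val j).+1 < val k)%N -> g j * g k = g k * g j) /\
  (forall j k, val k = (val j).+1 -> g j * g k * g j = g k * g j * g k).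

Lemma ext_gens_braid n (A : pzRingType) (g : gen_index n -> A) :
  braid_gens g -> braid_family (ext_gens g).
Proof.
move=> [gC gB]; split=> [j k jk|j]; rewrite /ext_gens.
  (* Every letter occurs on both sides of a relation, so an index out of range makes both vanish. *)
  case: insubP => [u _ uj|_]; case: insubP => [v _ vk|_] /=;
    rewrite ?mulr0 ?mul0r //.
  by apply: gC; rewrite uj vk.
case: insubP => [u _ uj|_]; case: insubP => [v _ vk|_] /=;
  rewrite ?mulr0 ?mul0r //.
by apply: gB; rewrite uj vk.
Qed.

Lemma prod_ext_gens n (A : pzRingType) (g : gen_index n -> A) s :
  \prod_(k <- s) g k = \prod_(k <- map val s) ext_gens g k.
Proof. by rewrite big_map; apply: eq_bigr => k _; rewrite /ext_gens valK. Qed.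

Lemma hecke_braid_gens (F : fieldType) n (q : F) :
  braid_gens (@hecke_gen F n q).
Proof.
split=> [j k jk|j k jk]; last exact: hecke_gen_braid.
by apply: hecke_gen_commute; rewrite addn2 jk.
Qed.

Lemma simple_transpE n (k : gen_index n) (a b : 'I_n) :
  a.+1 = val k -> b = val k :> nat -> simple_transp k = tperm a b.
Proof. by rewrite /simple_transp => <- bk; rewrite -transpE bk. Qed.

(* Points are numbered from 0: the letter k exchanges the points k-1 and k. *)
Lemma gen_points n (k : gen_index n) :
  exists a b : 'I_n, a.+1 = val k /\ b = val k :> nat.
Proof.
case: k => k /= /andP[k0 kn]; have kn' := leq_ltn_trans (leq_pred k) kn.
by exists (Ordinal kn'), (Ordinal kn); rewrite /= prednK.
Qed.

Lemma simple_transp_sqr n (k : gen_index n) :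
  (simple_transp k * simple_transp k = 1)%g.
Proof.
have [a [b [ak bk]]] := gen_points k.
by rewrite (simple_transpE ak bk) tperm2.
Qed.

Lemma simple_transpC n (j k : gen_index n) : ((val j).+1 < val k)%N ->
  (simple_transp j * simple_transp k = simple_transp k * simple_transp j)%g.
Proof.
have [a [b [aj bj]]] := gen_points j; have [c [d [ck dk]]] := gen_points k.
move=> jk; rewrite (simple_transpE aj bj) (simple_transpE ck dk).
have [ac ad bc bd]: [/\ a != c, a != d, b != c & b != d].
  by split; rewrite -val_eqE /=; lia.
have := tpermJ c d (tperm a b).
rewrite !tpermD // conjgE tpermV => e; apply: (mulgI (tperm a b)).
by rewrite e mulgA tperm2 mul1g.
Qed.

Lemma simple_transp_braid n (j k : gen_index n) : val k = (val j).+1 ->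
  (simple_transp j * simple_transp k * simple_transp j =
   simple_transp k * simple_transp j * simple_transp k)%g.
Proof.
have [a [b [aj bj]]] := gen_points j; have [c [d [ck dk]]] := gen_points k.
move=> kj; have ecb : c = b by apply: val_inj; rewrite /= bj; lia.
rewrite (simple_transpE aj bj) (simple_transpE ck dk) ecb.
have [ab ad bd]: [/\ a != b, a != d & b != d].
  by split; rewrite -val_eqE /=; lia.
have := tpermJ b d (tperm a b); have := tpermJ a b (tperm b d).
rewrite tpermR tpermL !tpermD // 1?eq_sym // !conjgE !tpermV !mulgA.
by move=> -> ->.
Qed.

(** As [braid_gens] lives in rings, the symmetric group enters through its faithful matrix
    representation. *)
Lemma perm_mx_braid_gens n :
  braid_gens (fun k : gen_index n => perm_mx (simple_transp k) : 'M[int]_n).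
Proof.
split=> j k jk; rewrite -!mulmxE -!perm_mxM; congr perm_mx.
  exact: simple_transpC.
exact: simple_transp_braid.
Qed.

Lemma word_perm_mx n (s : seq (gen_index n)) :
  perm_mx (word_perm s) =
  \prod_(k <- s) (perm_mx (simple_transp k) : 'M[int]_n).
Proof.
rewrite /word_perm; elim: s => [|k s IHs]; first by rewrite !big_nil perm_mx1.
by rewrite !big_cons perm_mxM IHs.
Qed.

Lemma perm_mx_int_inj n : injective (@perm_mx int n).
Proof.
move=> s t /matrixP e; apply/perm.permP => i; move: (e i (s i)).
by rewrite !mxE eqxx; case: eqP.
Qed.

(** * Normal form of reduced words *)

Section TranspositionWords.
Variables (n m : nat).
Hypothesis mn : m.+1 = n.
Local Notation letter_seq := (seq (gen_index n)).

(* Quantifying over all braid families captures equality of the images both in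
   the Hecke algebra and, through permutation matrices, in the symmetric group. *)
Definition word_equiv (s t : letter_seq) : Prop :=
  size s = size t /\
  forall (A : pzRingType) (g : gen_index n -> A), braid_gens g ->
    \prod_(k <- s) g k = \prod_(k <- t) g k.

Lemma word_equiv_perm s t : word_equiv s t -> word_perm s = word_perm t.
Proof.
move=> [_ st]; apply: perm_mx_int_inj.
by rewrite !word_perm_mx st //; apply: perm_mx_braid_gens.
Qed.

Lemma word_equiv_trans s t u :
  word_equiv s t -> word_equiv t u -> word_equiv s u.
Proof.
by case=> h1 h2 [h3 h4]; split=> [|A g hg]; [rewrite h1 | rewrite h2 ?h4].
Qed.

Lemma word_equiv_cat s s' t t' :
  word_equiv s s' -> word_equiv t t' -> word_equiv (s ++ t) (s' ++ t').
Proof.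
case=> h1 h2 [h3 h4]; split=> [|A g hg]; first by rewrite !size_cat h1 h3.
by rewrite !big_cat /= h2 // h4.
Qed.

Definition reduced (s : letter_seq) : Prop := reduced_word (word_perm s) s.

Lemma word_equiv_reduced s t : word_equiv s t -> reduced s -> reduced t.
Proof.
move=> st [_ red_s]; split=> // u; rewrite -(word_equiv_perm st) => /red_s.
by rewrite st.1.
Qed.

Lemma reduced_catl s t : reduced (s ++ t) -> reduced s.
Proof.
move=> [_ red_st]; split=> // u eu.
have := red_st (u ++ t); rewrite !word_perm_cat eu => /(_ erefl).
by rewrite !size_cat leq_add2r.
Qed.

Lemma run_commute (v : letter_seq) i (k : gen_index n) :
  map val v = rev (index_iota i n) -> ((val k).+1 < i)%N ->
  word_equiv (rcons v k) (k :: v).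
Proof.
move=> ev ki; split=> [|A g hg]; first by rewrite size_rcons.
rewrite !prod_ext_gens map_rcons ev -cats1 big_cat big_seq1 /= ev big_cons.
exact: desc_comml (ext_gens_braid hg) _ _ _ ki.
Qed.

Lemma run_shift (v : letter_seq) i (k k' : gen_index n) :
  map val v = rev (index_iota i n) -> (i <= val k')%N ->
  val k = (val k').+1 ->
  word_equiv (rcons v k) (k' :: v).
Proof.
move=> ev ik kk'; split=> [|A g hg]; first by rewrite size_rcons.
rewrite !prod_ext_gens map_rcons ev -cats1 big_cat big_seq1 /= ev big_cons kk'.
apply: (desc_shift (ext_gens_braid hg) ik).
by rewrite -kk'; case/andP: (valP k).
Qed.

(* Right multiplication by a letter k of a descending run n-1, ..., i either
   moves a letter < n-1 to the left of the run, or lengthens the run (k = i-1),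
   or shortens it (k = i); the last case contradicts reducedness. *)
Lemma reduced_decomp s : reduced s ->
  exists u v i, [/\ word_equiv s (u ++ v), all (fun k => val k < m)%N u,
    (0 < i <= n)%N & map val v = rev (index_iota i n)].
Proof.
elim/last_ind: s => [|s k IHs] red_sk.
  (* The value i = n encodes the empty run. *)
  exists [::], [::], n; split=> //; first by rewrite -mn leqnn.
  by rewrite /index_iota subnn.
have red_s : reduced s by move: red_sk; rewrite -cats1 => /reduced_catl.
have [u [v [i [e_s lt_u /andP[i0 i_n] ev]]]] := IHs red_s.
have e_sk : word_equiv (rcons s k) (u ++ rcons v k).
  by rewrite -!cats1 catA; apply: word_equiv_cat.
have move_left k' : (val k' < m)%N -> word_equiv (rcons v k) (k' :: v) ->
    exists u v i, [/\ word_equiv (rcons s k) (u ++ v),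
      all (fun k => val k < m)%N u, (0 < i <= n)%N &
      map val v = rev (index_iota i n)].
  move=> k'm e_v; exists (rcons u k'), v, i; split=> //.
  - apply: word_equiv_trans e_sk _; rewrite cat_rcons.
    exact: word_equiv_cat.
  - by rewrite all_rcons k'm.
  - by rewrite i0.
have [k0 kn] := andP (valP k).
have [ki|ik|ki] := ltngtP (val k) i.
- move: ki; rewrite leq_eqVlt => /orP[/eqP ki|ki].
    exists u, (rcons v k), (val k); split=> //; first by rewrite k0 ltnW.
    by rewrite map_rcons ev -ki [RHS]rev_iotaSl.
  apply: (move_left k); last exact: run_commute ev ki.
  by lia.
- have k'P : (0 < (val k).-1 < n)%N by lia.
  have k'm : ((val k).-1 < m)%N by lia.
  have [ik' ek'] : (i <= (val k).-1)%N /\ val k = (val k).-1.+1 by lia.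
  by apply: (move_left (exist _ (val k).-1 k'P)) => //; apply: run_shift ev _ _.
- have [v' ev'] : exists v' : letter_seq, v = rcons v' k.
    case/lastP: v ev {e_s e_sk move_left} => [|v' k'].
      by rewrite -ki rev_iotaSl // => /(congr1 size); rewrite size_rcons.
    rewrite -ki rev_iotaSl // map_rcons => /rcons_inj[_ /val_inj->].
    by exists v'.
  have [_ /(_ (u ++ v'))] := word_equiv_reduced e_sk red_sk.
  rewrite ev' -!cats1 !word_perm_cat /word_perm !big_seq1 -!mulgA.
  rewrite simple_transp_sqr mulg1 => /(_ erefl).
  by rewrite !size_cat /= leq_add2l !addn1 => /ltnW; rewrite ltnn.
Qed.

End TranspositionWords.

(** * Motion of points under words, and the reduced words of (i,n) *)

Lemma perm_step n (k : gen_index n) (x : 'I_n) :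
  (simple_transp k x <= x.+1)%N /\
  (simple_transp k x = x.+1 :> nat -> val k = x.+1).
Proof.
have [a [b [ak bk]]] := gen_points k; rewrite (simple_transpE ak bk).
case: tpermP => [->|->|_ _].
- by rewrite -ak bk -ak; split.
- by split; lia.
- by split; lia.
Qed.

Lemma word_perm_rise n (s : seq (gen_index n)) (x : 'I_n) :
  (word_perm s x <= x + size s)%N.
Proof.
elim: s x => [|k s IHs] x; first by rewrite /word_perm big_nil perm1 addn0.
rewrite /word_perm big_cons permM; apply: leq_trans (IHs _) _.
by rewrite /= addnS -addSn leq_add2r; have [] := perm_step k x.
Qed.

(** A letter lifts a point by at most one, so a maximal rise makes every letter lift it, and only
    the letter x+1 lifts x. *)
Lemma word_perm_max_rise n (s : seq (gen_index n)) (x : 'I_n) :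
  (x + size s <= word_perm s x)%N -> map val s = iota x.+1 (size s).
Proof.
elim: s x => [//|k s IHs] x.
rewrite /word_perm big_cons permM /= -/(word_perm s) => le_xs.
have [le_k eq_k] := perm_step k x.
have hk : simple_transp k x = x.+1 :> nat.
  apply/eqP; rewrite eqn_leq le_k /=.
  move: (leq_trans le_xs (word_perm_rise s _)).
  by rewrite addnS -addSn leq_add2r.
by rewrite eq_k // (IHs (simple_transp k x)) ?hk ?addSnnS.
Qed.

(** Each conjugation by a simple transposition adds two letters; this bounds the length of reduced
    words of a transposition. *)
Lemma tperm_word_size n d (a b : 'I_n) : (a + d.+1 = b)%N ->
  exists2 s, word_perm s = tperm a b & size s = d.*2.+1.
Proof.
elim: d b => [|d IHd] b hab.
  have hk : (0 < b < n)%N by rewrite ltn_ord -hab addn1.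
  exists [:: exist _ (val b) hk] => //; rewrite /word_perm big_seq1.
  by apply: simple_transpE; rewrite //= -hab addn1.
have hc : (a + d.+1 < n)%N.
  by apply: leq_ltn_trans (ltn_ord b); rewrite -hab leq_add2l.
pose c := Ordinal hc.
have [s hs ss] := IHd c erefl.
have hk : (0 < b < n)%N by rewrite ltn_ord -hab addnS.
pose k : gen_index n := exist _ (val b) hk.
have ek : simple_transp k = tperm c b.
  by apply: simple_transpE; rewrite //= -hab -addnS.
exists (rcons (k :: s) k); last by rewrite size_rcons /= ss doubleS.
rewrite -cats1 -cat1s !word_perm_cat hs /word_perm !big_seq1 ek.
have ca : c != a by rewrite -val_eqE /= -[X in _ != X]addn0 eqn_add2l.
have ba : b != a by rewrite -val_eqE /= -hab -[X in _ != X]addn0 eqn_add2l.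
have := tpermJ a c (tperm c b); rewrite tpermL (tpermD ca ba) => <-.
by rewrite conjgE tpermV mulgA.
Qed.

Lemma word_perm_fix n m (u : seq (gen_index n)) (x : 'I_n) :
  all (fun k => val k < m)%N u -> (m <= x)%N -> word_perm u x = x.
Proof.
move=> + mx; elim: u => [|k u IHu] /=.
  by rewrite /word_perm big_nil perm1.
case/andP=> km /IHu eu; rewrite /word_perm big_cons permM -/(word_perm u).
have [a [b [ak bk]]] := gen_points k.
have bx : (b < x)%N by rewrite bk (leq_trans km).
have ax : (a < x)%N by rewrite ltnW // ak -bk.
by rewrite (simple_transpE ak bk) tpermD // -val_eqE /= neq_ltn ?ax ?bx.
Qed.

Lemma run_perm_top n (v : seq (gen_index n)) i p (x : 'I_n) :
  (0 < i <= p)%N -> map val v = rev (index_iota i p) -> x.+1 = p ->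
  (word_perm v x).+1 = i.
Proof.
move=> /andP[i0]; elim: p v x => [|p IHp] v x; first by rewrite leqNgt i0.
rewrite leq_eqVlt => /orP[/eqP-> | ip].
  rewrite /index_iota subnn; case: v => //= _.
  by rewrite /word_perm big_nil perm1.
rewrite rev_iotaSr //; case: v => // k v [kp ev] [xp].
have [a [b [ak bk]]] := gen_points k.
rewrite /word_perm big_cons permM (simple_transpE ak bk).
have -> : x = b by apply: val_inj; rewrite /= xp bk -kp.
by rewrite tpermR; apply: IHp ip ev _; rewrite ak.
Qed.

(** Once a letter of the run has lifted the point, the remaining smaller letters fix it. *)
Lemma run_perm_rise n (v : seq (gen_index n)) i p (x : 'I_n) :
  map val v = rev (index_iota i p) -> (word_perm v x <= x.+1)%N.
Proof.
elim: p v x => [|p IHp] v x.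
  by case: v => // _; rewrite /word_perm big_nil perm1.
have [ip|pi] := leqP i p; last first.
  rewrite /index_iota (eqP pi); case: v => // _.
  by rewrite /word_perm big_nil perm1.
rewrite rev_iotaSr //; case: v => // k v [kp ev].
have [a [b [ak bk]]] := gen_points k.
rewrite /word_perm big_cons permM (simple_transpE ak bk) -/(word_perm v).
case: tpermP => [->|->|_ _]; last exact: IHp.
  have lt_v : all (fun k => val k < p)%N v.
    rewrite -(all_map val (fun k => k < p)%N) ev; apply/allP => l.
    by rewrite mem_rev mem_index_iota => /andP[].
  by rewrite (word_perm_fix lt_v) ?ak -?bk //= bk -kp.
by apply: leq_trans (IHp _ _ ev) _; rewrite ak -bk.
Qed.

Lemma Tw_transp (F : fieldType) m (q : F) i : (0 < i <= m)%N ->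
  Tw q (transp m.+1 i m.+1) =
  asc (Ts m.+1 q) i m * desc (Ts m.+1 q) i m.+1.
Proof.
case: i => // a /= am.
pose a' : 'I_m.+1 := Ordinal (leqW am).
rewrite (transpE a' ord_max) /Tw /some_reduced_word; case: cid => s /= red_s.
have red_s' : reduced s by rewrite /reduced red_s.1.
have [u [v [j [e_s lt_u jm ev]]]] := reduced_decomp erefl red_s'.
have e_perm := word_equiv_perm e_s; rewrite red_s.1 word_perm_cat in e_perm.
have ej : j = a.+1.
  rewrite -(run_perm_top (x := ord_max) jm ev) //.
  move/(congr1 (fun w : 'S_m.+1 => val (w ord_max))): e_perm.
  rewrite permM (word_perm_fix lt_u) // tpermR => <-.
  by [].
(* A reduced word has at most 2(m-a-1) + 1 letters, and v takes m-a of them. *)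
have size_u : (a + size u <= m.-1)%N.
  have dm : (a' + (m - a.+1).+1 = @ord_max m)%N.
    by rewrite subnSK // subnKC // ltnW.
  have [t et st] := tperm_word_size dm.
  have := red_s.2 _ et; rewrite st e_s.1 size_cat.
  rewrite -[size v](size_map val) ev size_rev size_iota ej; lia.
(* Since v lifts a point by at most one, u must already carry a to m-1 or higher, the most its
   length allows. *)
have eu : map val u = iota a.+1 (m - a.+1).
  have rise_u : (a' + size u <= word_perm u a')%N.
    apply: leq_trans size_u _.
    move/(congr1 (fun w : 'S_m.+1 => val (w a'))): e_perm.
    rewrite permM tpermL => e; have := run_perm_rise (word_perm u a') ev.
    by rewrite -e /=; lia.
  rewrite (word_perm_max_rise rise_u); congr iota.
  move: e_perm => /(congr1 (fun w : 'S_m.+1 => val (w a'))).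
  rewrite permM tpermL => e; have := run_perm_rise (word_perm u a') ev.
  have := word_perm_rise u a'; rewrite -e /=; lia.
rewrite e_s.2; last exact: hecke_braid_gens.
by rewrite prod_ext_gens map_cat big_cat eu ev ej.
Qed.

(** * Specialization to the Hecke algebra *)

Theorem theorem1p6 (R : realType) (n : nat) (hn : (0 < n)%N) (q : R[i]) :
  Bm n q n * Rm n q n
  = (q *: Rm n q n.-1 + (qint n q)%:A + qnJM n q) * Bm n q n.
Proof.
case: n hn => [hn|m _]; first case: (notF hn).
(* [Ts] is by definition the extension by zero of the generators. *)
have braidT := ext_gens_braid (@hecke_braid_gens _ m.+1 q).
have quadT k : (0 < k <= m)%N ->
    Ts m.+1 q k * Ts m.+1 q k = (q - 1) *: Ts m.+1 q k + q%:A.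
  by move=> km; rewrite /Ts insubT; apply: hecke_gen_quadratic.
rewrite /qnJM.
have -> : \sum_(1 <= i < m.+1) q ^+ i *: Tw q (transp m.+1 i m.+1) =
    \sum_(1 <= i < m.+1) q ^+ i *:
      (asc (Ts m.+1 q) i m * desc (Ts m.+1 q) i m.+1).
  by apply: eq_big_nat => i im; rewrite Tw_transp.
exact: B_Bs_B braidT quadT.
Qed.
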